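(* Let $k\ge 1$ and $m_1,\dots,m_k\ge 1$, and let $\bigvee_{i=1}^k P_{m_i}$ be the terminal wedge of the path graphs $P_{m_1},\dots,P_{m_k}$, i.e. the graph obtained by identifying one endpoint of each path $P_{m_i}$ into a single common vertex. Then the independence complex $\mathcal{I}\big(\bigvee_{i=1}^k P_{m_i}\big)$ is either contractible or homotopy equivalent to a sphere.
   Context: The path graph $P_l$ has vertices $1,\dots,l$ with edges $\{i,i+1\}$; its endpoints (terminal vertices) are $1$ and $l$. The wedge of finitely many graphs $G_i=(V_i,E_i)$ at chosen vertices $a_i\in V_i$ has vertex set $\bigcup_i(V_i\setminus\{a_i\})\cup\{a\}$, with all edges of the $G_i$ not incident to $a_i$ together with edges $ab$ for each edge $a_ib$ of $G_i$; a terminal wedge of paths is one in which each chosen vertex $a_i$ is an endpoint of $P_{m_i}$. The independence complex $\mathcal{I}(G)$ is the simplicial complex whose simplices are the independent vertex sets of $G$. *)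

(* Defs.v *)
From HB Require Import structures.
From mathcomp Require Import all_boot all_order all_algebra.
From mathcomp Require Import all_classical all_reals.
From mathcomp Require Import topology normedtype.

Set Implicit Arguments.
Unset Strict Implicit.
Unset Printing Implicit Defensive.

Import Order.TTheory GRing.Theory Num.Theory.
Import numFieldNormedType.Exports.

Local Open Scope classical_set_scope.
Local Open Scope ring_scope.

Record sgraph := SGraph {
  vertex :> finType;
  edge : rel vertex;
  edge_sym : symmetric edge;
  edge_irrefl : irreflexive edge }.

Section PathGraph.
Local Open Scope nat_scope.
Variable l : nat.

(* The vertices 1, ..., l are shifted to 0, ..., l - 1. *)
Definition path_edge : rel 'I_l := fun i j => (i.+1 == j) || (j.+1 == i).

Lemma path_edge_sym : symmetric path_edge.
Proof. by move=> i j; rewrite /path_edge orbC. Qed.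

Lemma path_edge_irrefl : irreflexive path_edge.
Proof. by move=> i; rewrite /path_edge orbb gtn_eqF. Qed.

Definition path_graph : sgraph := SGraph path_edge_sym path_edge_irrefl.

Definition path_endpoint (i : path_graph) : Prop :=
  val i = 0 \/ val i = l.-1.

End PathGraph.

Section Wedge.
Variables (k : nat) (G : 'I_k -> sgraph) (a : forall i, G i).

(* [None] is the common vertex; [Some (Tagged _ x)] is a vertex x of G_i other
   than a_i. *)
Definition wedge_vertex : finType :=
  option {i : 'I_k & {x : G i | x != a i}}.

Definition wedge_edge : rel wedge_vertex := fun u v =>
  match u, v with
  | None, None => false
  | None, Some y => edge (a (tag y)) (val (tagged y))
  | Some x, None => edge (a (tag x)) (val (tagged x))
  | Some x, Some y =>
      (tag x == tag y) && edge (val (tagged x)) (val (tagged_as x y))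
  end.

Lemma wedge_edge_sym : symmetric wedge_edge.
Proof.
case=> [[i x]|] [[j y]|] //=; rewrite eq_sym.
have [eji|//] := eqVneq j i; case: i / eji x => x /=.
by rewrite !tagged_asE edge_sym.
Qed.

Lemma wedge_edge_irrefl : irreflexive wedge_edge.
Proof. by case=> [[i x]|] //=; rewrite tagged_asE edge_irrefl andbF. Qed.

Definition wedge : sgraph := SGraph wedge_edge_sym wedge_edge_irrefl.

End Wedge.

(* Abstract simplicial complexes on a finite vertex set; the empty set is
   allowed as a simplex. *)
Record simplicial_complex (V : finType) := SimplicialComplex {
  simplices : {set {set V}};
  simplices_down :
    forall A B : {set V}, A \subset B -> B \in simplices -> A \in simplices }.

Section IndependenceComplex.
Variable G : sgraph.

Definition independent (A : {set G}) : bool :=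
  [forall x in A, forall y in A, ~~ edge x y].

Lemma independent_down (A B : {set G}) :
  A \subset B -> B \in [set S | independent S]%SET ->
  A \in [set S | independent S]%SET.
Proof.
rewrite !inE => /fintype.subsetP sAB /'forall_in_forall_inP indB.
by apply/'forall_in_forall_inP => x /sAB xB y /sAB yB; exact: indB.
Qed.

Definition independence_complex : simplicial_complex G :=
  SimplicialComplex independent_down.

End IndependenceComplex.

Section Spaces.
Variable R : realType.

Definition unit_interval : topologicalType := set_type (`[0, 1]%classic : set R).

Lemma unit_interval0 : (0 : R) \in (`[0, 1]%classic : set R).
Proof. by rewrite inE /= in_itv /= lexx ler01. Qed.

Lemma unit_interval1 : (1 : R) \in (`[0, 1]%classic : set R).
Proof. by rewrite inE /= in_itv /= lexx ler01. Qed.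

Definition I0 : unit_interval := exist _ 0 unit_interval0.
Definition I1 : unit_interval := exist _ 1 unit_interval1.

Definition homotopic (X Y : topologicalType) (f g : X -> Y) : Prop :=
  exists H : X * unit_interval -> Y,
    [/\ continuous H, forall x, H (x, I0) = f x & forall x, H (x, I1) = g x].

Definition homotopy_equivalent (X Y : topologicalType) : Prop :=
  exists (f : X -> Y) (g : Y -> X),
    [/\ continuous f, continuous g,
        homotopic (g \o f) idfun & homotopic (f \o g) idfun].

Definition contractible (X : topologicalType) : Prop :=
  exists x0 : X, homotopic idfun (fun _ : X => x0).

(* Barycentric coordinates. V being finite, the topology induced by the product
   topology of R^V is the usual one. *)
Definition realization_set (V : finType) (K : simplicial_complex V) :
    set {ptws V -> R} :=
  [set x | [/\ forall v, 0 <= x v, \sum_v x v = 1 &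
               [set v | x v != 0]%SET \in simplices K]].

Definition realization (V : finType) (K : simplicial_complex V) :
  topologicalType := set_type (realization_set K).

Definition sphere_set (n : nat) : set 'rV[R]_n.+1 :=
  [set x | \sum_i x 0 i ^+ 2 = 1].

Definition sphere (n : nat) : topologicalType := set_type (@sphere_set n).

End Spaces.

(* Main.v *)
Require Import Defs.
From mathcomp Require Import all_boot all_order all_algebra.
From mathcomp Require Import all_classical all_reals.
From mathcomp Require Import topology normedtype realfun.
From mathcomp Require Import zify lra.

(** The wedge is a forest: with respect to the distance to the common vertex,
    every vertex has at most one neighbour that is not farther away.  For a set
    [W] of vertices of such a graph, let [X_W] be the realization of the complex
    of independent subsets of [W].
    - If [u <> v] lie in [W] and all neighbours of [u] in [W] are neighbours of
      [v], then moving the mass of [v] to [u] is a deformation retraction of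
      [X_W] onto [X_(W - v)].
    - If [W] has an isolated vertex, then [X_W] is a cone, hence contractible.
    - Otherwise [W] induces a perfect matching, because a farthest vertex of
      degree at least 2 has a leaf [u] and another neighbour [v], and these are
      as in the first case.  Then [X_W] is the boundary of a cross-polytope,
      which radial projection identifies with a sphere. *)

Set Implicit Arguments.
Unset Strict Implicit.
Unset Printing Implicit Defensive.

Import Order.TTheory GRing.Theory Num.Theory.
Import numFieldNormedType.Exports.

Local Open Scope classical_set_scope.
Local Open Scope ring_scope.

(** * Continuity of maps built from coordinates and real operations *)

Lemma comp_continuous (X Y Z : topologicalType) (f : X -> Y) (g : Y -> Z) :
  continuous f -> continuous g -> continuous (fun x => g (f x)).
Proof.
by move=> cf cg x; apply: (@continuous_comp _ _ _ f g); [exact: cf | exact: cg].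
Qed.

Lemma pair_continuous (X Y Z : topologicalType) (f : X -> Y) (g : X -> Z) :
  continuous f -> continuous g -> continuous (fun x => (f x, g x)).
Proof.
move=> cf cg x; apply: (@cvg_pair _ _ _ (nbhs x) (nbhs (f x)) (nbhs (g x))).
  exact: cf.
exact: cg.
Qed.

Lemma fst_continuous (X Y : topologicalType) : continuous (@fst X Y).
Proof. by case=> x y; exact: cvg_fst. Qed.

Lemma snd_continuous (X Y : topologicalType) : continuous (@snd X Y).
Proof. by case=> x y; exact: cvg_snd. Qed.

Lemma continuous_set_type (T U : topologicalType) (A : set U)
    (f : T -> set_type A) :
  continuous (fun x => val (f x)) -> continuous f.
Proof. by move=> cf; apply: continuous_comp_initial. Qed.

Lemma continuous_val (U : topologicalType) (A : set U) :
  continuous (val : set_type A -> U).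
Proof. exact: initial_continuous. Qed.

Lemma continuous_ptws (T Y : topologicalType) (V : eqType)
    (f : T -> {ptws V -> Y}) :
  (forall v, continuous (fun x => f x v)) -> continuous f.
Proof.
move=> cf x; apply/cvg_sup => v.
exact: (@continuous_comp_initial _ _ _ (@proj V (fun=> Y) v) f (cf v) x).
Qed.

Lemma continuous_coord (T Y : topologicalType) (V : eqType)
    (f : T -> {ptws V -> Y}) v :
  continuous f -> continuous (fun x => f x v).
Proof.
move=> cf x; apply: (@continuous_comp _ _ _ f (@proj V (fun=> Y) v)).
  exact: cf.
exact: proj_continuous.
Qed.

(** A neighbourhood of a matrix contains a box of entrywise neighbourhoods, and only finitely many
    entries have to be controlled at once. *)
Lemma continuous_mx (T Y : topologicalType) p q (f : T -> 'M[Y]_(p, q)) :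
  (forall i j, continuous (fun x => f x i j)) -> continuous f.
Proof.
move=> cf x A [P xP PA].
suff: \forall y \near x, forall i j, P i j (f y i j).
  by apply: filterS => y /= Py; apply: PA.
apply: filter_forall => i; apply: filter_forall => j.
exact: (cf i j x _ (xP i j)).
Qed.

Lemma continuous_sum (R : realType) (T : topologicalType) (I : finType)
    (F : I -> T -> R) :
  (forall i, continuous (F i)) -> continuous (fun x => \sum_i F i x).
Proof.
move=> cF; rewrite /index_enum.
elim: Finite.enum => [|i s IH] x.
  under eq_fun do rewrite big_nil.
  exact: cvg_cst.
under eq_fun do rewrite big_cons.
apply: (@cvgD _ _ _ (nbhs x)); [exact: cF | exact: IH].
Qed.

Lemma continuous_maxr (R : realType) (T : topologicalType) (f g : T -> R) :
  continuous f -> continuous g -> continuous (fun x => Num.max (f x) (g x)).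
Proof. exact: max_fun_continuous. Qed.

Lemma continuous_minr (R : realType) (T : topologicalType) (f g : T -> R) :
  continuous f -> continuous g -> continuous (fun x => Num.min (f x) (g x)).
Proof. exact: min_fun_continuous. Qed.

Lemma continuous_addr (R : realType) (T : topologicalType) (f g : T -> R) :
  continuous f -> continuous g -> continuous (fun x => f x + g x).
Proof.
by move=> cf cg x; apply: (@cvgD _ _ _ (nbhs x)); [exact: cf | exact: cg].
Qed.

Lemma continuous_subr (R : realType) (T : topologicalType) (f g : T -> R) :
  continuous f -> continuous g -> continuous (fun x => f x - g x).
Proof.
by move=> cf cg x; apply: (@cvgB _ _ _ (nbhs x)); [exact: cf | exact: cg].
Qed.

Lemma continuous_mulr (R : realType) (T : topologicalType) (f g : T -> R) :
  continuous f -> continuous g -> continuous (fun x => f x * g x).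
Proof.
by move=> cf cg x; apply: (@cvgM _ _ (nbhs x)); [exact: cf | exact: cg].
Qed.

Lemma continuous_invr (R : realType) (T : topologicalType) (f : T -> R) :
  (forall x, f x != 0) -> continuous f -> continuous (fun x => (f x)^-1).
Proof. by move=> f0 cf x; apply: (@cvgV _ _ (nbhs x)) => //; exact: cf. Qed.

(** * Homotopies and homotopy equivalences *)

Section Homotopy.
Variable R : realType.
Implicit Types W X Y Z : topologicalType.

Local Notation I := (unit_interval R).

Lemma clamp_subproof (t : R) :
  Num.max 0 (Num.min 1 t) \in (`[0, 1]%classic : set R).
Proof.
by rewrite inE /= in_itv /= le_max lexx ge_max ler01 ge_min lexx.
Qed.

(** The retraction of the real line onto the unit interval. It lets a homotopy be reparametrized by
    any real formula in the time, with no membership proof. *)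
Definition clamp (t : R) : I :=
  exist _ (Num.max 0 (Num.min 1 t)) (clamp_subproof t).

Lemma clamp_continuous : continuous clamp.
Proof.
apply: continuous_set_type => /=.
apply: continuous_maxr; first exact: cst_continuous.
apply: continuous_minr; first exact: cst_continuous.
by move=> t; exact: cvg_id.
Qed.

Lemma clamp0 (t : R) : t <= 0 -> clamp t = I0 R.
Proof.
move=> t0; apply: val_inj => /=; apply/max_l; rewrite ge_min t0 orbT //.
Qed.

Lemma clamp1 (t : R) : 1 <= t -> clamp t = I1 R.
Proof. by move=> t1; apply: val_inj => /=; rewrite min_l// max_r. Qed.

Lemma unit_interval_ge0 (t : I) : 0 <= val t :> R.
Proof. by case: t => t /= /set_mem; rewrite /= in_itv => /andP[]. Qed.

Lemma unit_interval_le1 (t : I) : val t <= 1 :> R.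
Proof. by case: t => t /= /set_mem; rewrite /= in_itv => /andP[]. Qed.

Lemma homotopic_refl X Y (f : X -> Y) : continuous f -> homotopic R f f.
Proof.
move=> cf; exists (fun xt => f xt.1); split=> //.
exact: comp_continuous (@fst_continuous _ _) cf.
Qed.

Definition time X (xt : X * I) : R := val xt.2.

Lemma time_continuous X : continuous (@time X).
Proof. exact: comp_continuous (@snd_continuous _ _) (@continuous_val _ _). Qed.

Lemma reparam_continuous X Y (H : X * I -> Y) (c : R -> R) :
  continuous H -> continuous c ->
  continuous (fun xt => H (xt.1, clamp (c (time xt)))).
Proof.
move=> cH cc; apply: comp_continuous cH; apply: pair_continuous.
  exact: fst_continuous.
apply: comp_continuous clamp_continuous.
exact: comp_continuous (@time_continuous X) cc.
Qed.

Lemma homotopic_sym X Y (f g : X -> Y) : homotopic R f g -> homotopic R g f.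
Proof.
move=> [H [cH H0 H1]].
exists (fun xt => H (xt.1, clamp (1 - time xt))); split=> [|x|x] /=.
- apply: (@reparam_continuous _ _ H (fun t => 1 - t)) => // t.
  by apply: cvgB; [exact: cvg_cst | exact: cvg_id].
- by rewrite /time /= subr0 clamp1.
- by rewrite /time /= subrr clamp0.
Qed.

Lemma homotopic_trans X Y (f g h : X -> Y) :
  homotopic R f g -> homotopic R g h -> homotopic R f h.
Proof.
move=> [F [cF F0 F1]] [G [cG G0 G1]].
pose F' (xt : X * I) := F (xt.1, clamp (2 * time xt)).
pose G' (xt : X * I) := G (xt.1, clamp (2 * time xt - 1)).
have cF' : continuous F'.
  apply: (@reparam_continuous _ _ F (fun t => 2 * t)) => // t.
  by apply: cvgM; [exact: cvg_cst | exact: cvg_id].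
have cG' : continuous G'.
  apply: (@reparam_continuous _ _ G (fun t => 2 * t - 1)) => // t.
  apply: cvgB; last exact: cvg_cst.
  by apply: cvgM; [exact: cvg_cst | exact: cvg_id].
(* Concatenation at double speed. At time 1/2 both formulas give the middle map [g], so either one
   describes [H] there. *)
pose H (xt : X * I) := if time xt <= 2^-1 then F' xt else G' xt.
have HG xt : 2^-1 <= time xt -> H xt = G' xt.
  rewrite /H => le2; case: ifP => // ge2.
  have t2 : time xt = 2^-1 by apply/eqP; rewrite eq_le ge2.
  have e : 2 * time xt = 1 by rewrite t2 divff ?pnatr_eq0.
  by rewrite /F' /G' e subrr clamp1// clamp0// F1 G0.
have HF xt : time xt <= 2^-1 -> H xt = F' xt by rewrite /H => ->.
exists H; split=> [|x|x].
- apply/continuous_subspace_setT.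
  (* Pasting lemma: the two halves of the cylinder are closed, and [H] is continuous on each. *)
  have -> : [set: X * I] = @time X @^-1` [set t | t <= 2^-1] `|`
    @time X @^-1` [set t | 2^-1 <= t].
    apply/seteqP; split=> // xt _ /=.
    by case: (leP (time xt) 2^-1) => [|/ltW]; [left | right].
  apply: withinU_continuous.
  + exact: (continuous_closedP _).1 (@time_continuous X) _ (@closed_le _ _).
  + exact: (continuous_closedP _).1 (@time_continuous X) _ (@closed_ge _ _).
  + apply: (@subspace_eq_continuous _ _ _ F').
      by move=> xt /set_mem /= xtP; exact/esym/HF.
    exact: continuous_subspaceT.
  + apply: (@subspace_eq_continuous _ _ _ G').
      by move=> xt /set_mem /= xtP; exact/esym/HG.
    exact: continuous_subspaceT.
- rewrite HF ?invr_ge0// /F' /= mulr0 clamp0 //.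
- have e : 2 * time (x, I1 R) - 1 = 1 by rewrite /time /=; lra.
  by rewrite HG /G' /= ?e ?clamp1 //; rewrite /time /=; lra.
Qed.

Lemma homotopic_comp W X Y Z (a : W -> X) (f g : X -> Y) (b : Y -> Z) :
  continuous a -> continuous b -> homotopic R f g ->
  homotopic R (b \o f \o a) (b \o g \o a).
Proof.
move=> ca cb [H [cH H0 H1]].
exists (fun xt => b (H (a xt.1, xt.2))); split=> [|x|x] /=; last 2 first.
- by rewrite H0.
- by rewrite H1.
apply: comp_continuous cb; apply: comp_continuous cH.
apply: pair_continuous; last exact: snd_continuous.
exact: comp_continuous (@fst_continuous _ _) ca.
Qed.

Lemma homotopy_equivalent_trans X Y Z :
  homotopy_equivalent R X Y -> homotopy_equivalent R Y Z ->
  homotopy_equivalent R X Z.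
Proof.
move=> [f [g [cf cg gf fg]]] [f' [g' [cf' cg' gf' fg']]].
exists (f' \o f), (g \o g'); split.
- exact: comp_continuous.
- exact: comp_continuous.
(* The inner composite [g' \o f'] is first deformed to the identity between [f] and [g]; the other
   side is symmetric. *)
- apply: (homotopic_trans _ gf).
  exact: (homotopic_comp cf cg gf').
- apply: (homotopic_trans _ fg').
  exact: (homotopic_comp cg' cf' fg).
Qed.

(** The identity of [X] deforms to [g \o f], which factors through [Y] and so deforms to the
    constant [g y0]. *)
Lemma homotopy_equivalent_contractible X Y :
  homotopy_equivalent R X Y -> contractible R Y -> contractible R X.
Proof.
move=> [f [g [cf cg gf fg]]] [y0 hy]; exists (g y0).
apply: (homotopic_trans (homotopic_sym gf)).
exact: (homotopic_comp cf cg hy).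
Qed.

End Homotopy.

(** * Realizations of simplicial complexes, contiguity, cones and folds *)

Section Realization.
Variables (R : realType) (V : finType).
Implicit Types (K L : simplicial_complex V) (T : topologicalType).

Definition support (x : V -> R) : {set V} := [set v | x v != 0]%SET.

Definition coord K (x : realization R K) : V -> R := val x.

Lemma coord_inj K : injective (@coord K).
Proof. exact: val_inj. Qed.

Lemma coordP K (x : realization R K) : realization_set K (coord x).
Proof. exact: set_mem (valP x). Qed.

Lemma coord_ge0 K (x : realization R K) v : 0 <= coord x v.
Proof. by have [] := coordP x. Qed.

Lemma coord_sum K (x : realization R K) : \sum_v coord x v = 1.
Proof. by have [] := coordP x. Qed.

Lemma coord_support K (x : realization R K) : support (coord x) \in simplices K.
Proof. by have [] := coordP x. Qed.

Lemma coord_continuous K v : continuous (fun x : realization R K => coord x v).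
Proof. exact: continuous_coord (@continuous_val _ _). Qed.

Definition of_coord K (x : V -> R) (xP : realization_set K x) :
  realization R K := exist _ (x : {ptws V -> R}) (mem_set xP).

Lemma of_coordK K (x : V -> R) (xP : realization_set K x) :
  coord (of_coord xP) = x.
Proof. by []. Qed.

Lemma of_coord_continuous T K (f : T -> V -> R)
    (fP : forall x, realization_set K (f x)) :
  (forall v, continuous (fun x => f x v)) ->
  continuous (fun x => of_coord (fP x)).
Proof.
move=> cf; apply: continuous_set_type.
exact: (@continuous_ptws T R V f).
Qed.

(** The straight-line homotopy works: a convex combination of [f x] and [g x] is supported in the
    union of their supports, which is a simplex. *)
Lemma contiguous_homotopic T K (f g : T -> realization R K) :
  continuous f -> continuous g ->
  (forall x, support (coord (f x)) :|: support (coord (g x))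
     \in simplices K)%SET ->
  homotopic R f g.
Proof.
move=> cf cg fgK.
pose h (xt : T * unit_interval R) v :=
  (1 - time xt) * coord (f xt.1) v + time xt * coord (g xt.1) v.
have hP xt : realization_set K (h xt).
  have t0 : 0 <= time xt := unit_interval_ge0 xt.2.
  have t1 : time xt <= 1 := unit_interval_le1 xt.2.
  split.
  - move=> v; apply: addr_ge0; apply: mulr_ge0; rewrite ?coord_ge0 ?subr_ge0//.
  - by rewrite big_split /= -!mulr_sumr !coord_sum !mulr1 subrK.
  - apply: simplices_down (fgK xt.1); apply/fintype.subsetP => v.
    rewrite !inE /h; apply: contraR; rewrite negb_or !negbK.
    by move=> /andP[/eqP-> /eqP->]; rewrite !mulr0 addr0.
exists (fun xt => of_coord (hP xt)); split=> [|x|x]; last 2 first.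
- apply: coord_inj; rewrite of_coordK; apply/funext => v.
  by rewrite /h /time /= subr0 mul1r mul0r addr0.
- apply: coord_inj; rewrite of_coordK; apply/funext => v.
  by rewrite /h /time /= subrr mul1r mul0r add0r.
have coord_fst_continuous k v : continuous k ->
    continuous (fun xt : T * unit_interval R =>
      coord (k xt.1 : realization R K) v).
  move=> ck; apply: (@comp_continuous _ _ _ fst (fun x => coord (k x) v)).
    exact: fst_continuous.
  exact: comp_continuous ck (@coord_continuous K v).
have ct := @time_continuous R T.
apply: of_coord_continuous => v; apply: continuous_addr.
  apply: continuous_mulr; last exact: coord_fst_continuous.
  by apply: continuous_subr => //; exact: cst_continuous.
by apply: continuous_mulr => //; exact: coord_fst_continuous.
Qed.

(** The identity is contiguous to the constant map at the apex [u]. That the empty set is a simplex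
    makes the apex itself a point of the realization. *)
Lemma cone_contractible K (u : V) :
  finset.set0 \in simplices K ->
  (forall S : {set V}, S \in simplices K -> u |: S \in simplices K)%SET ->
  contractible R (realization R K).
Proof.
move=> K0 Ku; pose e v : R := (v == u)%:R.
have eu v : (e v != 0) = (v == u).
  by rewrite /e; case: (v == u); rewrite ?oner_eq0 ?eqxx.
have eP : realization_set K e.
  split.
  - by move=> v; rewrite ler0n.
  - rewrite (bigD1 u)//= big1 ?addr0 /e ?eqxx// => v /negbTE->//.
  - apply: simplices_down (Ku _ K0); apply/fintype.subsetP => v.
    by rewrite !inE eu orbF.
exists (of_coord eP); apply: contiguous_homotopic.
- by move=> x; exact: cvg_id.
- exact: cst_continuous.
move=> x; apply: simplices_down (Ku _ (coord_support x)).
apply/fintype.subsetP => v; rewrite !inE of_coordK eu.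
by case/orP=> ->; rewrite ?orbT.
Qed.

Lemma fold_homotopy_equivalent K L (u v : V) : u != v ->
  (forall S : {set V},
     S \in simplices K -> v \in S -> u |: S \in simplices K)%SET ->
  (forall S : {set V},
     (S \in simplices L) = (S \in simplices K) && (v \notin S)) ->
  homotopy_equivalent R (realization R K) (realization R L).
Proof.
move=> uv Kuv LE.
(* The retraction moves all the mass of [v] onto [u]. *)
pose r (x : realization R K) w : R :=
  if w == v then 0 else coord x w + (w == u)%:R * coord x v.
(* If [v] carries no mass, [r x] is [x]. Otherwise both supports lie in [u |: support x], a simplex
   by [Kuv]. Hence [r] is contiguous to the identity. *)
have rsupp x : (support (r x) :|: support (coord x) \in simplices K)%SET.
  have [xv|xv] := eqVneq (coord x v) 0.
    apply: simplices_down (coord_support x); apply/fintype.subsetP => w.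
    rewrite !inE /r; have [_|_] := eqVneq w v; rewrite ?eqxx//=.
    by rewrite xv mulr0 addr0 orbb.
  have vx : v \in support (coord x) by rewrite inE.
  apply: simplices_down (Kuv _ (coord_support x) vx).
  apply/fintype.subsetP => w; rewrite !inE /r.
  have [_|_] := eqVneq w v; rewrite ?eqxx//=; first by move=> ->; rewrite orbT.
  by have [_|_] := eqVneq w u => //=; rewrite mul0r addr0 orbb.
have rP x : realization_set L (r x).
  split.
  - move=> w; rewrite /r; case: ifP => // _.
    by rewrite addr_ge0 ?mulr_ge0 ?coord_ge0 ?ler0n.
  - rewrite (bigD1 v)//= (bigD1 u)//= /r eqxx add0r (negbTE uv) eqxx mul1r.
    rewrite -(coord_sum x) [in RHS](bigD1 v)//= [in RHS](bigD1 u)//=.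
    rewrite addrCA -!addrA; congr (_ + (_ + _)).
    apply: eq_bigr => w /andP[/negbTE-> /negbTE->].
    by rewrite mul0r addr0.
  - rewrite LE [v \in _]inE /r !eqxx andbT.
    by apply: simplices_down (rsupp x); exact: finset.subsetUl.
have iP (x : realization R L) : realization_set K (coord x).
  by have [x0 x1] := coordP x; rewrite LE => /andP[].
have cr : continuous (fun x => of_coord (rP x)).
  apply: of_coord_continuous => w; rewrite /r; have [_|_] := eqVneq w v.
    exact: cst_continuous.
  apply: continuous_addr; first exact: coord_continuous.
  by apply: continuous_mulr; [exact: cst_continuous | exact: coord_continuous].
have ci : continuous (fun x => of_coord (iP x)).
  by apply: of_coord_continuous => w; exact: coord_continuous.
exists (fun x => of_coord (rP x)), (fun x => of_coord (iP x)); split=> //.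
- apply: contiguous_homotopic => [||x].
  + exact: comp_continuous cr ci.
  + by move=> x; exact: cvg_id.
  + exact: rsupp.
(* On the smaller complex the mass at [v] is zero, so [r] restricts to the identity exactly. *)
- rewrite (_ : _ \o _ = idfun).
    by apply: homotopic_refl => x; exact: cvg_id.
  apply/funext => x /=; apply: coord_inj; rewrite of_coordK.
  apply/funext => w; rewrite /r of_coordK.
  have xv : coord x v = 0.
    by have := coord_support x; rewrite LE inE negbK => /andP[_ /eqP].
  by have [->//|_] := eqVneq w v; rewrite xv mulr0 addr0.
Qed.

(** * The boundary of a cross-polytope is a sphere *)

Section CrossPolytope.
(** [e i] and [e' i] are antipodal vertices. The hypotheses say that the simplices are the sets of
    such vertices without an antipodal pair. [V] may contain further elements that are not vertices
    of [K]. *)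
Variables (n : nat) (e e' : 'I_n.+1 -> V).
Hypotheses (e_inj : injective e) (e'_inj : injective e').
Hypothesis ee' : forall i j, e i != e' j.
Variable K : simplicial_complex V.
Hypothesis K_cover :
  forall (S : {set V}) v, S \in simplices K -> v \in S ->
  exists i, v = e i \/ v = e' i.
Hypothesis KP : forall S : {set V},
  (forall v, v \in S -> exists i, v = e i \/ v = e' i) ->
  (S \in simplices K) = [forall i, ~~ ((e i \in S) && (e' i \in S))].

(** The odd extension of [y]: value [y i] at [e i], [- y i] at [e' i], and 0 elsewhere. Its positive
    part [pos y] splits each [y i] between the two antipodes, and [mass y] is the l1 norm of [y]. *)
Let signed (y : 'I_n.+1 -> R) v : R :=
  \sum_i y i * ((v == e i)%:R - (v == e' i)%:R).

Let pos y v := Num.max (signed y v) 0.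

Let mass y := \sum_v pos y v.

Let diff (x : V -> R) i := x (e i) - x (e' i).

Let norm (y : 'I_n.+1 -> R) := Num.sqrt (\sum_i y i ^+ 2).

Let signed_e y i : signed y (e i) = y i.
Proof.
rewrite /signed (bigD1 i)//= eqxx (negbTE (ee' _ _)) subr0 mulr1.
rewrite big1 ?addr0// => j ji.
by rewrite (inj_eq e_inj) eq_sym (negbTE ji) (negbTE (ee' _ _)) subr0 mulr0.
Qed.

Let signed_e' y i : signed y (e' i) = - y i.
Proof.
have e'e a b : (e' a == e b) = false by rewrite eq_sym (negbTE (ee' _ _)).
rewrite /signed (bigD1 i)//= eqxx e'e sub0r mulrN1.
rewrite big1 ?addr0// => j ji.
by rewrite e'e (inj_eq e'_inj) eq_sym (negbTE ji) subr0 mulr0.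
Qed.

Let signed_cover y v : signed y v != 0 -> exists i, v = e i \/ v = e' i.
Proof.
move=> yv; apply: contrapT => nv; move: yv; rewrite /signed big1 ?eqxx// => i _.
have [vi|_] := eqVneq v (e i); first by case: nv; exists i; left.
have [vi|_] := eqVneq v (e' i); first by case: nv; exists i; right.
by rewrite subrr mulr0.
Qed.

Let signedZ c y v : signed (fun i => c * y i) v = c * signed y v.
Proof. by rewrite /signed mulr_sumr; apply: eq_bigr => i _; rewrite mulrA. Qed.

Let posZ c y v : 0 <= c -> pos (fun i => c * y i) v = c * pos y v.
Proof. by move=> c0; rewrite /pos signedZ maxr_pMr// mulr0. Qed.

Let massZ c y : 0 <= c -> mass (fun i => c * y i) = c * mass y.
Proof.
by move=> c0; rewrite /mass mulr_sumr; apply: eq_bigr => v _; rewrite posZ.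
Qed.

Let normZ c y : 0 <= c -> norm (fun i => c * y i) = c * norm y.
Proof.
move=> c0; rewrite /norm -[in RHS](ger0_norm c0) -sqrtr_sqr -sqrtrM ?sqr_ge0//.
by rewrite mulr_sumr; congr Num.sqrt; apply: eq_bigr => i _; rewrite exprMn.
Qed.

Let pos_ge0 y v : 0 <= pos y v.
Proof. by rewrite le_max lexx orbT. Qed.

Let mass_gt0 y i : y i != 0 -> 0 < mass y.
Proof.
move=> yi; rewrite lt_neqAle sumr_ge0 ?andbT//; apply/eqP => /esym/eqP.
rewrite psumr_eq0// => /allP y0.
(* With zero mass the positive parts of both [y i] and [- y i] vanish, which forces [y i = 0]. *)
have pos0 v : pos y v = 0 by apply/eqP/y0/mem_index_enum.
have := pos0 (e i); have := pos0 (e' i); rewrite /pos signed_e signed_e'.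
by move/eqP: yi; case: leP => ?; case: leP => ?; lra.
Qed.

(** A simplex contains no antipodal pair, so at most one of the coordinates at [e i] and [e' i] is
    nonzero. Their difference therefore determines both, as its positive and negative parts. *)
Let pos_diff (x : realization R K) v : pos (diff (coord x)) v = coord x v.
Proof.
have x0 := coord_ge0 x.
have xx i : coord x (e i) = 0 \/ coord x (e' i) = 0.
  have := coord_support x; rewrite KP; last first.
    by move=> w; apply: K_cover (coord_support x).
  move=> /forallP /(_ i); rewrite !inE negb_and !negbK.
  by case/orP=> /eqP; [left | right].
rewrite /pos /diff; have [xv|xv] := eqVneq (coord x v) 0; last first.
  have [|i [vE|vE]] := K_cover (coord_support x) (v := v); first by rewrite inE.
    rewrite vE signed_e; have := x0 (e i).
    case: (xx i) => [e0|->]; last by rewrite subr0 => ?; rewrite max_l.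
    by rewrite vE e0 eqxx in xv.
  rewrite vE signed_e'; have := x0 (e' i).
  case: (xx i) => [->|e0]; first by rewrite sub0r opprK => ?; rewrite max_l.
  by rewrite vE e0 eqxx in xv.
(* With no mass at [v], the signed value there is minus the coordinate at the antipode, so its
   positive part is 0. *)
rewrite xv; have [->|sv] := eqVneq (signed (diff (coord x)) v) 0.
  by rewrite maxxx.
have [i [vE|vE]] := signed_cover sv; subst v.
  by rewrite signed_e max_r// xv sub0r oppr_le0.
by rewrite signed_e' max_r// xv subr0 oppr_le0.
Qed.

Let diff_pos y i : diff (pos y) i = y i.
Proof.
by rewrite /diff /pos signed_e signed_e'; case: leP => ?; case: leP => ?; lra.
Qed.

Let mass_diff (x : realization R K) : mass (diff (coord x)) = 1.
Proof.
by rewrite -(coord_sum x); apply: eq_bigr => v _; rewrite pos_diff.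
Qed.

Let norm_gt0 y i : y i != 0 -> 0 < norm y.
Proof.
move=> yi; rewrite sqrtr_gt0 (bigD1 i)//= ltr_pwDl ?exprn_even_gt0//.
by rewrite sumr_ge0// => j _; rewrite sqr_ge0.
Qed.

Let diff_neq0 (x : realization R K) : exists i, diff (coord x) i != 0.
Proof.
apply: contrapT => d0.
have := mass_diff x; rewrite /mass big1 => [/eqP|v _].
  by rewrite eq_sym oner_eq0.
rewrite /pos /signed big1 ?maxxx// => i _.
have [->|di] := eqVneq (diff (coord x) i) 0; first by rewrite mul0r.
by case: d0; exists i.
Qed.

Let norm_diff_gt0 (x : realization R K) : 0 < norm (diff (coord x)).
Proof. by have [i] := diff_neq0 x; exact: norm_gt0. Qed.

Let row_of (y : 'I_n.+1 -> R) : 'rV[R]_n.+1 := \row_i y i.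

Let to_sphere_subproof (x : realization R K) :
  row_of (fun i => (norm (diff (coord x)))^-1 * diff (coord x) i)
    \in @sphere_set R n.
Proof.
rewrite inE /sphere_set /=.
under eq_bigr do rewrite mxE exprMn.
rewrite -mulr_sumr exprVn sqr_sqrtr ?mulVf//.
  by rewrite gt_eqF// -sqrtr_gt0; exact: norm_diff_gt0.
by rewrite sumr_ge0// => j _; rewrite sqr_ge0.
Qed.

(** Radial projection: divide by the Euclidean norm. The inverse [of_sphere] divides by the l1 norm
    instead. *)
Let to_sphere (x : realization R K) : sphere R n :=
  exist _ (row_of _) (to_sphere_subproof x).

Let row_entry (y : sphere R n) i : R := (val y : 'rV[R]_n.+1) 0 i.

Let row_entry_sum y : \sum_i row_entry y i ^+ 2 = 1.
Proof. exact: set_mem (valP y). Qed.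

Let norm_row_entry y : norm (row_entry y) = 1.
Proof. by rewrite /norm row_entry_sum sqrtr1. Qed.

Let row_mass_gt0 y : 0 < mass (row_entry y).
Proof.
have [i yi] : exists i, row_entry y i != 0; last exact: mass_gt0 yi.
apply: contrapT => y0; have := row_entry_sum y; rewrite big1 => [/eqP|i _].
  by rewrite eq_sym oner_eq0.
have [->|yi] := eqVneq (row_entry y i) 0; first by rewrite expr0n.
by case: y0; exists i.
Qed.

Let of_sphere_subproof (y : sphere R n) : realization_set K
  (fun v => (mass (row_entry y))^-1 * pos (row_entry y) v).
Proof.
have m0 := row_mass_gt0 y; split.
- by move=> v; rewrite mulr_ge0// invr_ge0 ltW.
- by rewrite -mulr_sumr mulVf// gt_eqF.
(* Vertices in the support have positive signed value, while the values at antipodes are opposite;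
   hence no antipodal pair occurs. *)
have sgn v : (mass (row_entry y))^-1 * pos (row_entry y) v != 0 ->
    0 < signed (row_entry y) v.
  rewrite mulf_eq0 negb_or => /andP[_]; rewrite /pos.
  by case: leP; rewrite ?eqxx.
rewrite KP.
  apply/forallP => i; rewrite !inE; apply/negP => /andP[/sgn + /sgn].
  by rewrite signed_e signed_e' oppr_gt0 => /lt_trans h /h; rewrite ltxx.
by move=> v; rewrite inE => /sgn /lt0r_neq0 /signed_cover.
Qed.

Let of_sphere (y : sphere R n) : realization R K :=
  of_coord (of_sphere_subproof y).

Let diff_continuous i :
  continuous (fun x : realization R K => diff (coord x) i).
Proof. by apply: continuous_subr; exact: coord_continuous. Qed.

Let to_sphere_continuous : continuous to_sphere.
Proof.
apply: continuous_set_type; apply: continuous_mx => k i.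
rewrite (_ : (fun x => _) = fun x : realization R K =>
    (norm (diff (coord x)))^-1 * diff (coord x) i); last first.
  by apply/funext => x; rewrite mxE.
apply: continuous_mulr; last exact: diff_continuous.
apply: continuous_invr => [x|]; first by rewrite gt_eqF.
apply: (@comp_continuous _ _ _
  (fun x : realization R K => \sum_i diff (coord x) i ^+ 2) Num.sqrt).
  apply: continuous_sum => j.
  exact: continuous_mulr (@diff_continuous j) (@diff_continuous j).
exact: sqrt_continuous.
Qed.

Let row_entry_continuous i : continuous (fun y => row_entry y i).
Proof.
have cM : continuous (fun M : 'rV[R]_n.+1 => M 0 i).
  exact: matrix_normedtype.coord_continuous.
exact: comp_continuous (@continuous_val _ (@sphere_set R n)) cM.
Qed.

Let pos_continuous v : continuous (fun y => pos (row_entry y) v).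
Proof.
apply: continuous_maxr; last exact: cst_continuous.
apply: continuous_sum => i; apply: continuous_mulr; last exact: cst_continuous.
exact: row_entry_continuous.
Qed.

Let of_sphere_continuous : continuous of_sphere.
Proof.
apply: of_coord_continuous => v.
apply: continuous_mulr; last exact: pos_continuous.
apply: continuous_invr => [y|]; first by rewrite gt_eqF.
exact: continuous_sum.
Qed.

(** The two projections are mutually inverse, so both homotopies are constant. As [pos], [mass] and
    [norm] are positively homogeneous, the two scalings cancel. *)
Lemma cross_polytope_sphere :
  homotopy_equivalent R (realization R K) (sphere R n).
Proof.
exists to_sphere, of_sphere; split=> //.
- rewrite (_ : _ \o _ = idfun).
    by apply: homotopic_refl => x; exact: cvg_id.
  apply/funext => x /=; apply: coord_inj; rewrite of_coordK; apply/funext => v.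
  have -> : row_entry (to_sphere x) =
      fun i => (norm (diff (coord x)))^-1 * diff (coord x) i.
    by apply/funext => i; rewrite /row_entry /= mxE.
  have N0 := norm_diff_gt0 x.
  rewrite posZ ?massZ ?invr_ge0 ?(ltW N0)// mass_diff pos_diff mulr1 invrK.
  by rewrite mulrA mulfV ?mul1r// gt_eqF.
- rewrite (_ : _ \o _ = idfun).
    by apply: homotopic_refl => x; exact: cvg_id.
  apply/funext => y /=; apply: val_inj => /=; apply/rowP => i; rewrite mxE.
  have m0 := row_mass_gt0 y.
  rewrite (_ : diff _ = fun i => (mass (row_entry y))^-1 * row_entry y i).
    rewrite normZ ?invr_ge0 ?ltW// norm_row_entry mulr1 invrK.
    by rewrite mulrA mulfV ?mul1r// gt_eqF.
  by apply/funext => j; rewrite /diff of_coordK -mulrBr -/(diff _ j) diff_pos.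
Qed.

End CrossPolytope.

End Realization.

(** * Independence complexes of forests *)

Section Forest.
Variables (R : realType) (G : sgraph) (h : G -> nat).
Hypothesis h_parent : forall v u w : G, edge v u -> edge v w ->
  (h u <= h v)%N -> (h w <= h v)%N -> u = w.
Implicit Types (S W : {set G}) (u v w : G).

Lemma independentP S :
  reflect (forall u v, u \in S -> v \in S -> ~~ edge u v) (independent S).
Proof.
apply: (iffP forall_inP) => [SP u v uS vS|SP u uS].
  exact: (forall_inP (SP u uS)).
by apply/forall_inP => v vS; exact: SP.
Qed.

Lemma indep_in_down W S S' : S \subset S' ->
  S' \in [set A : {set G} | independent A & A \subset W]%SET ->
  S \in [set A : {set G} | independent A & A \subset W]%SET.
Proof.
move=> SS'; rewrite !inE => /andP[iS' S'W]; apply/andP; split.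
  have := @independent_down G S S' SS'; rewrite !inE; exact.
exact: fintype.subset_trans S'W.
Qed.

(** Induced subgraphs are encoded by restricting the simplices rather than the vertex type, so
    deleting a vertex leaves the type unchanged. *)
Definition indep_in W : simplicial_complex G :=
  SimplicialComplex (@indep_in_down W).

Lemma indep_inE W S :
  (S \in simplices (indep_in W)) = independent S && (S \subset W).
Proof. by rewrite inE. Qed.

Lemma independent_setU1 u S : independent S ->
  (forall w, w \in S -> ~~ edge u w) -> independent (u |: S)%SET.
Proof.
move=> /independentP Si uS; apply/independentP => x y.
rewrite !inE => /orP[/eqP->|xS] /orP[/eqP->|yS].
- by rewrite edge_irrefl.
- exact: uS.
- by rewrite edge_sym; exact: uS.
- exact: Si.
Qed.

Lemma isolated_contractible W u : u \in W ->
  (forall w, w \in W -> ~~ edge u w) ->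
  contractible R (realization R (indep_in W)).
Proof.
move=> uW uN; apply: (@cone_contractible _ _ _ u).
  rewrite indep_inE finset.sub0set andbT.
  by apply/independentP => x y; rewrite inE.
move=> S; rewrite !indep_inE => /andP[Si SW].
rewrite finset.subUset finset.sub1set uW SW !andbT.
apply: independent_setU1 => // w /(fintype.subsetP SW); exact: uN.
Qed.

(** An independent set containing [v] has no neighbour of [v], hence none of [u], so [u] can be
    added and the fold applies. *)
Lemma dominated_homotopy_equivalent W u v : u \in W -> u != v ->
  (forall w, w \in W -> edge u w -> edge v w) ->
  homotopy_equivalent R (realization R (indep_in W))
    (realization R (indep_in (W :\ v)%SET)).
Proof.
move=> uW uv uvN; apply: (@fold_homotopy_equivalent _ _ _ _ u v) => // S.
  rewrite !indep_inE => /andP[Si SW] vS.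
  rewrite finset.subUset finset.sub1set uW SW !andbT.
  apply: independent_setU1 => // w wS; apply/negP => uw.
  move/independentP: Si => /(_ v w vS wS) /negP; apply.
  by apply: uvN => //; exact: (fintype.subsetP SW).
by rewrite !indep_inE finset.subsetD1 andbA.
Qed.

(** * Induced perfect matchings *)

Section Matching.
Variables (W : {set G}) (s : G -> G).
Hypotheses (sW : forall v, v \in W -> s v \in W)
  (s_edge : forall v, v \in W -> edge v (s v))
  (s_uniq : forall v w, v \in W -> w \in W -> edge v w -> w = s v).

Lemma partnerK v : v \in W -> s (s v) = v.
Proof.
move=> vW; apply/esym/s_uniq => //; first exact: sW.
by rewrite edge_sym; exact: s_edge.
Qed.

Lemma matching_sphere : W != finset.set0 ->
  exists n, homotopy_equivalent R (realization R (indep_in W)) (sphere R n).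
Proof.
move=> /set0Pn[v0 v0W].
(* One vertex is chosen from each matched pair, the one of smaller rank. With n + 1 pairs the sphere
   has dimension n. *)
pose A := [set v in W | (enum_rank v < enum_rank (s v))%N]%SET.
have AW v : v \in A -> v \in W by rewrite inE => /andP[].
have As v : v \in W -> v \in A \/ s v \in A.
  move=> vW; rewrite !inE vW sW// partnerK//=.
  case: ltngtP; [by left | by right |].
  move=> /ord_inj /enum_rank_inj sv.
  by have := s_edge vW; rewrite -sv edge_irrefl.
have [n An] : exists n, #|A| = n.+1.
  have : (0 < #|A|)%N.
    by apply/card_gt0P; case: (As _ v0W) => ?; [exists v0 | exists (s v0)].
  by case: #|A| => // n _; exists n.
pose e i : G := enum_val (cast_ord (esym An) i).
have eA i : e i \in A := enum_valP _.
have eW i : e i \in W := AW _ (eA i).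
have e_inj : injective e by move=> i j /enum_val_inj /cast_ord_inj.
have eP v : v \in A -> exists i, v = e i.
  move=> vA; exists (cast_ord An (enum_rank_in vA v)).
  by rewrite /e cast_ordK enum_rankK_in.
have cover v : v \in W -> exists i, v = e i \/ v = s (e i).
  move=> vW; case: (As v vW) => /eP[i vE]; exists i; first by left.
  by right; rewrite -vE partnerK.
have coverW v : (exists i, v = e i \/ v = s (e i)) -> v \in W.
  by move=> [i [->|->]]; [|apply: sW]; exact: eW.
exists n; apply: (@cross_polytope_sphere _ _ _ e (s \o e)) => //=.
- by move=> i j /(congr1 s); rewrite !partnerK// => /e_inj.
- move=> i j; apply/eqP => eij; have := eA i; have := eA j.
  rewrite eij !inE partnerK// => /andP[_ lt1] /andP[_ lt2].
  by have := ltn_trans lt1 lt2; rewrite ltnn.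
- move=> S v; rewrite indep_inE => /andP[_ /fintype.subsetP SW] /SW.
  exact: cover.
- move=> S Scover; rewrite indep_inE.
  have -> : S \subset W by apply/fintype.subsetP => v /Scover /coverW.
  (* The only edges inside [W] are the matched pairs, so independence means containing no pair. *)
  rewrite andbT; apply/independentP/forallP => [Si i|SP u v uS vS].
    apply/negP => /andP[eS seS]; have := Si _ _ eS seS.
    by rewrite s_edge.
  apply/negP => uv.
  have uW := coverW _ (Scover _ uS); have vW := coverW _ (Scover _ vS).
  have vE := s_uniq uW vW uv; have [i [uE|uE]] := Scover _ uS.
    by have := SP i; rewrite -uE -vE uS vS.
  by have := SP i; rewrite -uE uS andbT -{1}(partnerK (eW i)) -uE -vE vS.
Qed.

End Matching.

(** Take [w] of maximal height among the vertices with two neighbours in [W]. By [h_parent], one of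
    any two such neighbours is higher than [w]; by maximality [w] is its only neighbour in [W], so
    the other neighbour dominates it. *)
Lemma dominated_or_uniq_neighbour W :
  (exists u v, [/\ u \in W, v \in W, u != v &
     forall w, w \in W -> edge u w -> edge v w]) \/
  (forall u v w, u \in W -> v \in W -> w \in W ->
     edge u v -> edge u w -> v = w).
Proof.
pose B := [set w in W |
  [exists u in W, exists v in W, [&& u != v, edge w u & edge w v]]]%SET.
have [B0|[w0 w0B]] := set_0Vmem B.
  right=> u v w uW vW wW uv uw; apply/eqP; apply: contraT => vw.
  suff: u \in (finset.set0 : {set G}) by rewrite finset.in_set0.
  rewrite -B0 inE uW; apply/exists_inP; exists v => //.
  by apply/exists_inP; exists w => //; rewrite vw uv uw.
left; case: (@arg_maxnP _ w0 (fun w => w \in B) h w0B) => w + wmax.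
rewrite inE => /andP[wW /exists_inP[u1 u1W /exists_inP[u2 u2W]]].
move=> /and3P[u12 wu1 wu2].
have main u v : u \in W -> v \in W -> u != v -> edge w u -> edge w v ->
    (h w < h u)%N -> forall x, x \in W -> edge u x -> edge v x.
  move=> uW vW uv wu wv hu x xW ux.
  have [->|xw] := eqVneq x w; first by rewrite edge_sym.
  suff /wmax : u \in B by rewrite /geq /= leqNgt hu.
  rewrite inE uW; apply/exists_inP; exists x => //.
  by apply/exists_inP; exists w => //; rewrite xw ux edge_sym.
case: (leqP (h u1) (h w)) => [h1|h1]; last first.
  by exists u1, u2; split=> //; exact: main.
case: (leqP (h u2) (h w)) => [h2|h2]; last first.
  by exists u2, u1; split; rewrite 1?eq_sym//; apply: main; rewrite 1?eq_sym.
by rewrite (h_parent wu1 wu2 h1 h2) eqxx in u12.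
Qed.

Theorem forest_independence_complex W : W != finset.set0 ->
  contractible R (realization R (indep_in W)) \/
  exists n, homotopy_equivalent R (realization R (indep_in W)) (sphere R n).
Proof.
(* Induction on the size of [W]: a dominating vertex [v] is deleted, and [u] keeps the remainder
   nonempty. *)
have [k] := ubnP #|W|; elim: k W => // k IH W; rewrite ltnS => Wk W0.
have [[u [v [uW vW uv uvN]]]|uniqN] := dominated_or_uniq_neighbour W.
  have eqv := dominated_homotopy_equivalent uW uv uvN.
  have [||c|[n sn]] := IH (W :\ v)%SET.
  - by rewrite (leq_trans _ Wk)// [in X in (_ < X)%N](cardsD1 v W) vW.
  - by apply/set0Pn; exists u; rewrite !inE uv.
  - by left; exact: homotopy_equivalent_contractible eqv c.
  - by right; exists n; exact: homotopy_equivalent_trans eqv sn.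
have [/exists_inP[u uW /forall_inP uN]|/exists_inPn noiso] :=
    boolP [exists u in W, [forall w in W, ~~ edge u w]].
  by left; exact: isolated_contractible uN.
(* The default [u] is never returned on [W], since no vertex of [W] is isolated in it. *)
right; pose s u := odflt u [pick w in W | edge u w].
have sP u : u \in W -> s u \in W /\ edge u (s u).
  move=> uW; rewrite /s; case: pickP => [w /andP[]//|noN].
  case/negP: (noiso u uW); apply/forall_inP => w wW.
  by have := noN w; rewrite /= wW /= => ->.
apply: (@matching_sphere _ s) => // [v /sP[]//|v /sP[]//|v w vW wW vw].
by have [svW vsv] := sP v vW; exact: uniqN vw vsv.
Qed.

Lemma forest_realization (v0 : G) :
  contractible R (realization R (independence_complex G)) \/
  exists n, homotopy_equivalent R (realization R (independence_complex G))
    (sphere R n).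
Proof.
(* The two complexes are different records with the same simplices; they are identified through
   their sets of points. *)
have E : realization_set (R := R) (indep_in [set: G]%SET) =
    realization_set (independence_complex G).
  apply/seteqP; split=> x [x0 x1 xS]; split=> //; move: xS.
    by rewrite indep_inE [in X in _ -> X]inE => /andP[].
  by rewrite indep_inE [in X in X -> _]inE finset.subsetT andbT.
have := @forest_independence_complex [set: G]%SET.
rewrite /realization E; apply; apply/set0Pn; exists v0; exact: finset.in_setT.
Qed.

End Forest.

(** * The height function on a wedge of paths *)

Lemma wedge_of_paths_parent (k : nat) (m : 'I_k -> nat)
    (a : forall i, path_graph (m i)) : (forall i, path_endpoint (a i)) ->
  exists h : wedge (G := fun i => path_graph (m i)) a -> nat,
    forall v u w, edge v u -> edge v w -> (h u <= h v)%N -> (h w <= h v)%N ->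
    u = w.
Proof.
(* With truncated subtraction one summand is always 0, so the sum is the absolute difference, the
   distance to [a i] along the path. *)
move=> aP; pose dist i (x : 'I_(m i)) : nat := ((x - a i) + (a i - x))%N.
exists (fun v : wedge_vertex a =>
  if v is Some x then dist (tag x) (sval (tagged x)) else 0%N).
(* The only neighbour of [x] that is not farther from [a i] is the next vertex towards [a i]. *)
have parent i (x y z : 'I_(m i)) : path_edge x y -> path_edge x z ->
    (dist i y <= dist i x)%N -> (dist i z <= dist i x)%N -> y = z.
  rewrite /path_edge /dist => xy xz yx zx; apply: val_inj => /=.
  move: (aP i) (ltn_ord x) (ltn_ord y) (ltn_ord z); rewrite /path_endpoint /=.
  by move: xy xz yx zx; lia.
have dist_a i : dist i (a i) = 0%N by rewrite /dist subnn.
have dist_edge i (x : 'I_(m i)) : path_edge (a i) x -> (0 < dist i x)%N.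
  by rewrite /path_edge /dist; lia.
(* The common vertex has height 0 and all its neighbours have positive height, so it has no
   parent. *)
case=> [[i x]|] u w; last first.
  by case: u => [[j y]|]//= /dist_edge y0 _; rewrite leqNgt y0.
case: u => [[j y]|] /=; case: w => [[j' y']|] //=.
- have [ij|//] := eqVneq i j; subst j; have [ij'|//] := eqVneq i j'; subst j'.
  rewrite !tagged_asE => xy xy' hy hy'.
  by congr (Some (Tagged _ _)); apply: val_inj; exact: parent hy hy'.
- have [ij|//] := eqVneq i j; subst j; rewrite tagged_asE /= => xy ax hy _.
  (* A parent other than the common vertex would coincide with [a i], which the type of wedge
     vertices excludes. *)
  have ya : val y = a i.
    by apply: (parent i (val x)) => //; rewrite ?dist_a// path_edge_sym.
  by have := valP y; rewrite ya eqxx.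
- have [ij|//] := eqVneq i j'; subst j'; rewrite tagged_asE /= => ax xy _ hy.
  have ya : val y' = a i.
    by apply: (parent i (val x)) => //; rewrite ?dist_a// path_edge_sym.
  by have := valP y'; rewrite ya eqxx.
Qed.

Theorem theorem3p8 (R : realType) (k : nat) (m : 'I_k -> nat)
    (a : forall i : 'I_k, path_graph (m i))
    (k_ge1 : (1 <= k)%N) (m_ge1 : forall i : 'I_k, (1 <= m i)%N)
    (a_terminal : forall i : 'I_k, path_endpoint (a i)) :
  let X := realization R
    (independence_complex (wedge (G := fun i : 'I_k => path_graph (m i)) a)) in
  contractible R X \/ exists n : nat, homotopy_equivalent R X (sphere R n).
Proof.
have [h hP] := wedge_of_paths_parent a_terminal.
(* [None], the common vertex, shows that the graph is nonempty. *)
exact: (forest_realization R hP None).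
Qed.
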